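(* Let $A\in\mathbb{C}^{n\times n}$ have index $k$ and let $m$ be a positive integer. Then the following assertions hold: (a) $r(A^{\mathrm{w}_m,\dagger})=r(A^k)$; (b) $\mathcal{R}(A^{\mathrm{w}_m,\dagger})=\mathcal{R}(A^k)$ and $\mathcal{N}(A^{\mathrm{w}_m,\dagger})=\mathcal{N}((A^k)^*A^{m+1}A^\dagger)$; (c) $A^{\mathrm{w}_m,\dagger}=A^{(2)}_{\mathcal{R}(A^k),\,\mathcal{N}((A^k)^*A^{m+1}A^\dagger)}$; (d) $AA^{\mathrm{w}_m,\dagger}=P_{\mathcal{R}(A^k),\,\mathcal{N}((A^k)^*A^{m+1}A^\dagger)}$; (e) $A^{\mathrm{w}_m,\dagger}A=P_{\mathcal{R}(A^k),\,\mathcal{N}((A^k)^*A^{m+1})}$.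
   Context: $r(\cdot)$, $\mathcal{R}(\cdot)$, $\mathcal{N}(\cdot)$, $(\cdot)^*$ denote rank, range, null space and conjugate transpose; $A^\dagger$ is the Moore-Penrose inverse and $A^D$ the Drazin inverse. The index of $A\in\mathbb{C}^{n\times n}$ is the smallest nonnegative integer $k$ with $r(A^{k+1})=r(A^k)$ (with $A^0=I_n$). For subspaces with $\mathcal{L}\oplus\mathcal{M}=\mathbb{C}^n$, $P_{\mathcal{L},\mathcal{M}}$ is the projector onto $\mathcal{L}$ along $\mathcal{M}$. $A^{(2)}_{\mathcal{T},\mathcal{S}}$ denotes the matrix $X$ (unique if it exists) with $XAX=X$, $\mathcal{R}(X)=\mathcal{T}$ and $\mathcal{N}(X)=\mathcal{S}$. For $A$ of index $k$, the core-EP inverse is $A^{\mathrm{cEP}}=A^DA^k(A^k)^\dagger$ and the $m$-weak group inverse is $A^{\mathrm{w}_m}=(A^{\mathrm{cEP}})^{m+1}A^m$. The $m$-weak group MP inverse $A^{\mathrm{w}_m,\dagger}$ is the unique $X\in\mathbb{C}^{n\times n}$ satisfying $XAX=X$, $AX=A_1A^\dagger$ and $XA=A^DA_1$, where $A_1=AA^{\mathrm{w}_m}A$. *)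

(* Defs.v *)
From HB Require Import structures.
From mathcomp Require Import all_boot all_order all_algebra.
From mathcomp Require Import reals complex.

Set Implicit Arguments.
Unset Strict Implicit.
Unset Printing Implicit Defensive.

Import Order.TTheory GRing.Theory Num.Theory.
Local Open Scope ring_scope.
Local Open Scope sesquilinear_scope.

Section Subspaces.
Variables (F : fieldType).

(* MathComp's matrix-space operations are about row spaces; here the range and
   the null space are those of the action x |-> A x on column vectors. *)
Definition mxrange m n (A : 'M[F]_(m, n)) : {vspace 'cV[F]_m} :=
  limg (linfun (fun x : 'cV[F]_n => A *m x)).

Definition mxnull m n (A : 'M[F]_(m, n)) : {vspace 'cV[F]_n} :=
  lker (linfun (fun x : 'cV[F]_n => A *m x)).

Lemma mxrangeP m n (A : 'M[F]_(m, n)) y :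
  reflect (exists x, y = A *m x) (y \in mxrange A).
Proof.
apply: (iffP memv_imgP) => [[x _ ->]|[x ->]]; exists x; rewrite ?memvf //.
  by rewrite lfunE.
by rewrite lfunE.
Qed.

Lemma mxnullE m n (A : 'M[F]_(m, n)) x : (x \in mxnull A) = (A *m x == 0).
Proof. by rewrite memv_ker lfunE. Qed.

(* P = P_{L,M}. As daddv_pi L M is total, the direct sum decomposition of the
   whole space, without which P_{L,M} is undefined, is part of the predicate. *)
Definition is_projector n (P : 'M[F]_n) (L M : {vspace 'cV[F]_n}) : Prop :=
  [/\ (L :&: M)%VS = 0%VS, (L + M)%VS = fullv
    & forall x, P *m x = daddv_pi L M x].

Lemma is_projectorP n (P : 'M[F]_n) (L M : {vspace 'cV[F]_n}) :
  is_projector P L M <->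
  [/\ (L :&: M)%VS = 0%VS, (L + M)%VS = fullv,
      forall u, u \in L -> P *m u = u & forall v, v \in M -> P *m v = 0].
Proof.
split=> [[dLM fLM PE]|[dLM fLM PL PM]]; split=> //.
- by move=> u Lu; rewrite PE daddv_pi_id.
- move=> v Mv; rewrite PE.
  have := daddv_pi_add dLM (_ : v \in (L + M)%VS).
  rewrite fLM memvf => /(_ isT); rewrite (@daddv_pi_id _ _ M L) 1?capvC //.
  by move/eqP; rewrite -subr_eq0 addrK => /eqP.
- move=> x; rewrite -{1}(@daddv_pi_add _ _ L M x dLM) ?fLM ?memvf //.
  by rewrite mulmxDr PL ?memv_pi // PM ?memv_pi ?addr0.
Qed.

(* X = A^(2)_{T,S}; see is_outer_inverse_unique. *)
Definition is_outer_inverse m n (A : 'M[F]_(m, n)) (T : {vspace 'cV[F]_n})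
    (S : {vspace 'cV[F]_m}) (X : 'M[F]_(n, m)) : Prop :=
  [/\ X *m A *m X = X, mxrange X = T & mxnull X = S].

Lemma colmx_ext m n (X Y : 'M[F]_(m, n)) :
  (forall v : 'cV[F]_n, X *m v = Y *m v) -> X = Y.
Proof.
by move=> XY; apply/matrixP=> i j; have /colP/(_ i) := XY (delta_mx j 0);
  rewrite -!colE !mxE.
Qed.

Lemma is_outer_inverse_unique m n (A : 'M[F]_(m, n)) T S X Y :
  is_outer_inverse A T S X -> is_outer_inverse A T S Y -> X = Y.
Proof.
move=> [XAX RX NX] [YAY RY NY].
have XAY : X *m A *m Y = Y.
  apply: colmx_ext => v; have : Y *m v \in mxrange X.
    by rewrite RX -RY; apply/mxrangeP; exists v.
  by case/mxrangeP=> w wE; rewrite -mulmxA wE mulmxA XAX.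
rewrite -[RHS]XAY; apply: colmx_ext => v.
have : v - A *m (Y *m v) \in mxnull X.
  by rewrite NX -NY mxnullE mulmxBr !mulmxA YAY subrr.
by rewrite mxnullE mulmxBr subr_eq0 !mulmxA => /eqP.
Qed.

End Subspaces.

Section Index.
Variables (F : fieldType) (n : nat).
Implicit Types A X : 'M[F]_n.

Lemma mxindex_exists A : exists k, \rank (A ^+ k.+1) == \rank (A ^+ k).
Proof.
have dec j : (\rank (A ^+ j.+1) <= \rank (A ^+ j))%N.
  by rewrite exprS; apply: mxrankM_maxr.
suff H d : forall j, (\rank (A ^+ j) <= d)%N ->
    exists k, \rank (A ^+ k.+1) == \rank (A ^+ k) by exact: (H _ 0%N (leqnn _)).
elim: d => [|d IH] j.
  by rewrite leqn0 => /eqP rj; exists j; rewrite rj -leqn0; have := dec j; rewrite rj.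
move=> rj; have := dec j; rewrite leq_eqVlt => /orP[e|lt]; first by exists j.
by apply: (IH j.+1); rewrite -ltnS (leq_trans lt).
Qed.

Definition mxindex A : nat := ex_minn (mxindex_exists A).

Lemma mxindexP A : \rank (A ^+ (mxindex A).+1) = \rank (A ^+ mxindex A).
Proof. by rewrite /mxindex; case: ex_minnP => k /eqP. Qed.

Definition is_drazin A X : bool :=
  [&& X *m A *m X == X, A *m X == X *m A
    & A ^+ (mxindex A).+1 *m X == A ^+ mxindex A].

Lemma mxindex_factor A :
  exists Y Z, A ^+ mxindex A = Y *m A ^+ (mxindex A).*2.+1
           /\ A ^+ mxindex A = A ^+ (mxindex A).*2.+1 *m Z.
Proof.
set k := mxindex A.
have [Y0 Y0E] : exists Y, A ^+ k = Y *m A ^+ k.+1.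
  have s : (A ^+ k.+1 <= A ^+ k)%MS by rewrite exprS submxMl.
  by apply/submxP; rewrite -(geq_leqif (mxrank_leqif_sup s)) mxindexP.
have [Z0 Z0E] : exists Z, A ^+ k = A ^+ k.+1 *m Z.
  have s : ((A ^+ k.+1)^T <= (A ^+ k)^T)%MS.
    by rewrite exprSr trmx_mul submxMl.
  have /submxP[W WE] : ((A ^+ k)^T <= (A ^+ k.+1)^T)%MS.
    by rewrite -(geq_leqif (mxrank_leqif_sup s)) !mxrank_tr mxindexP.
  by exists W^T; rewrite -[LHS]trmxK WE trmx_mul trmxK.
have YE j : exists Y, A ^+ k = Y *m A ^+ (k + j).
  elim: j => [|j [Y YE]]; first by exists 1%:M; rewrite mul1mx addn0.
  exists (Y *m Y0); rewrite addnS -addSn exprD -mulmxE -mulmxA [Y0 *m _]mulmxA.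
  by rewrite -Y0E [LHS]YE exprD.
have ZE j : exists Z, A ^+ k = A ^+ (k + j) *m Z.
  elim: j => [|j [Z ZE]]; first by exists 1%:M; rewrite mulmx1 addn0.
  exists (Z0 *m Z); rewrite addnS -addSn addnC exprD -mulmxE mulmxA -[_ *m Z0]mulmxA.
  by rewrite -Z0E [LHS]ZE addnC exprD.
have [Y YE1] := YE k.+1; have [Z ZE1] := ZE k.+1.
by exists Y, Z; rewrite -addnn -addnS.
Qed.

Lemma drazin_exists A : exists X, is_drazin A X.
Proof.
have [Y [Z []]] := mxindex_factor A; rewrite /is_drazin; set k := mxindex A.
set P := A ^+ k.*2.+1 => YE ZE.
have AP : A *m P = P *m A by rewrite /P -[LHS]exprS exprSr.
have Ak : A *m A ^+ k = A ^+ k *m A by rewrite -[LHS]exprS exprSr.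
have PE : P = A ^+ k *m A *m A ^+ k.
  by rewrite /P -addnn -addSn exprD exprSr !mulmxE.
have D : Y *m A ^+ k = A ^+ k *m Z by rewrite {1}ZE mulmxA -YE.
exists (Y *m A ^+ k); apply/and3P; split; apply/eqP.
- rewrite {2}D -!mulmxA; congr (Y *m _); rewrite !mulmxA -PE.
  by rewrite -ZE.
- rewrite {1}D !mulmxA Ak {1}YE -!mulmxA; congr (Y *m _); rewrite -Ak.
  by rewrite ZE !mulmxA AP.
- rewrite D mulmxA [X in _ = X]ZE; congr (_ *m Z).
  by rewrite /P -addnn -addSn exprD.
Qed.

Definition drazin A : 'M[F]_n := xchoose (drazin_exists A).

Lemma drazinP A : is_drazin A (drazin A).
Proof. exact: xchooseP. Qed.

Lemma drazin_unique A X Y : is_drazin A X -> is_drazin A Y -> X = Y.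
Proof.
have idem Z : is_drazin A Z -> forall j, Z ^+ j.+1 * A ^+ j.+1 = Z * A.
  move=> /and3P[/eqP ZAZ /eqP AZ _] j.
  rewrite -exprMn_comm; last by rewrite /GRing.comm -!mulmxE AZ.
  elim: j => [|j IH]; first by rewrite expr1.
  by rewrite exprS IH !mulrA -!mulmxE ZAZ.
have pow Z : is_drazin A Z -> forall j, Z ^+ j.+1 * A ^+ j = Z.
  move=> dZ [|j]; first by rewrite expr1 expr0 mulr1.
  rewrite exprS -mulrA idem // mulrA -!mulmxE.
  case/and3P: dZ => /eqP ZAZ /eqP AZ _.
  by rewrite -mulmxA -AZ mulmxA ZAZ.
have comX Z : is_drazin A Z -> forall i j, Z ^+ i * A ^+ j = A ^+ j * Z ^+ i.
  move=> /and3P[_ /eqP AZ _] i j; apply/commrX/commr_sym/commrX.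
  by rewrite /GRing.comm -!mulmxE AZ.
move=> dX dY; set k := mxindex A.
have /and3P[_ _ /eqP EX] := dX; have /and3P[_ _ /eqP EY] := dY.
transitivity (X * A * Y).
  by rewrite -{1}(pow _ dX k) -{1}EY mulmxE mulrA idem.
have XE : X * A ^+ k.+1 = A ^+ k.
  by rewrite -[RHS]EX mulmxE -[X in X * _]expr1 comX // expr1.
have AY : A * Y = Y * A by case/and3P: dY => _ /eqP.
by rewrite -[RHS](pow _ dY k) comX // -XE -[RHS]mulrA -comX // idem // -mulrA AY.
Qed.

End Index.

Section GeneralizedInverses.
Variables (C : numClosedFieldType).

Definition is_mpinv m n (A : 'M[C]_(m, n)) (X : 'M[C]_(n, m)) : bool :=
  [&& A *m X *m A == A, X *m A *m X == X,
      (A *m X)^t* == A *m X & (X *m A)^t* == X *m A].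

Lemma adjmxM m n p (A : 'M[C]_(m, n)) (B : 'M[C]_(n, p)) :
  (A *m B)^t* = B^t* *m A^t*.
Proof. by rewrite trmx_mul map_mxM. Qed.

Lemma adjmx_inv n (A : 'M[C]_n) : (invmx A)^t* = invmx (A^t*).
Proof. by rewrite trmx_inv map_invmx. Qed.

Lemma gram_eq0 m n (A : 'M[C]_(m, n)) : A *m A^t* = 0 -> A = 0.
Proof.
move=> AA0; apply/matrixP=> i j; rewrite [RHS]mxE.
have /eqP := congr1 (fun B : 'M[C]_m => B i i) AA0.
rewrite !mxE psumr_eq0 => [|l _]; last by rewrite !mxE mul_conjC_ge0.
by move=> /allP/(_ j (mem_index_enum _)); rewrite !mxE mul_conjC_eq0 => /eqP.
Qed.

Lemma gram_unit r n (G : 'M[C]_(r, n)) : row_free G -> G *m G^t* \in unitmx.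
Proof.
move=> Gfree; rewrite -row_free_unit; apply/row_freeP.
suff /eqP K0 : kermx (G *m G^t*) == 0.
  by apply/row_freeP; rewrite -kermx_eq0 K0.
rewrite -(mulmx_free_eq0 _ Gfree); apply/eqP/gram_eq0.
by rewrite adjmxM mulmxA -(mulmxA (kermx _)) mulmx_ker mul0mx.
Qed.

Lemma mpinv_exists m n (A : 'M[C]_(m, n)) : exists X, is_mpinv A X.
Proof.
have [r [H [G [AE Hfull Gfree]]]] : exists r (H : 'M_(m, r)) (G : 'M_(r, n)),
    [/\ A = H *m G, row_full H & row_free G].
  exists (\rank A), (col_base A), (row_base A).
  by rewrite mulmx_base col_base_full row_base_free.
pose U := G *m G^t*; pose V := H^t* *m H.
have Uu : U \in unitmx by apply/gram_unit.
have Vu : V \in unitmx.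
  have := @gram_unit _ _ (H^t*); rewrite trmxCK; apply.
  by rewrite /row_free mxrank_map mxrank_tr.
have Us : U^t* = U by rewrite adjmxM trmxCK.
have Vs : V^t* = V by rewrite adjmxM trmxCK.
pose X := G^t* *m invmx U *m invmx V *m H^t*.
have AX : A *m X = H *m invmx V *m H^t*.
  rewrite AE /X !mulmxA; congr (_ *m _ *m _).
  by rewrite -!mulmxA [G *m (_ *m _)]mulmxA mulmxV // mulmx1.
have XA : X *m A = G^t* *m invmx U *m G.
  rewrite AE /X -!mulmxA [H^t* *m (_ *m _)]mulmxA.
  by rewrite [invmx V *m (_ *m _)]mulmxA mulVmx // mul1mx.
exists X; apply/and4P; split; apply/eqP.
- by rewrite AX AE -!mulmxA [H^t* *m _]mulmxA mulKmx.
- by rewrite XA /X -!mulmxA [G *m (_ *m _)]mulmxA mulKmx.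
- by rewrite AX !adjmxM trmxCK adjmx_inv Vs mulmxA.
- by rewrite XA !adjmxM trmxCK adjmx_inv Us mulmxA.
Qed.

Definition mpinv m n (A : 'M[C]_(m, n)) : 'M[C]_(n, m) :=
  xchoose (mpinv_exists A).

Lemma mpinvP m n (A : 'M[C]_(m, n)) : is_mpinv A (mpinv A).
Proof. exact: xchooseP. Qed.

Lemma mpinv_unique m n (A : 'M[C]_(m, n)) X Y :
  is_mpinv A X -> is_mpinv A Y -> X = Y.
Proof.
move=> /and4P[/eqP AXA /eqP XAX /eqP AXs /eqP XAs].
move=> /and4P[/eqP AYA /eqP YAY /eqP AYs /eqP YAs].
have AXY : A *m X = A *m Y.
  by rewrite -[LHS]AXs -{1}AYA -mulmxA adjmxM AXs AYs mulmxA AXA.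
have XYA : X *m A = Y *m A.
  by rewrite -[LHS]XAs -{1}AYA -mulmxA mulmxA adjmxM XAs YAs -mulmxA
    [A *m (_ *m _)]mulmxA AXA.
by rewrite -XAX -mulmxA AXY mulmxA XYA YAY.
Qed.

Section Square.
Variables (n : nat).
Implicit Types A X : 'M[C]_n.

Definition cepinv A : 'M[C]_n :=
  drazin A *m A ^+ mxindex A *m mpinv (A ^+ mxindex A).

Definition wginv (m : nat) A : 'M[C]_n := cepinv A ^+ m.+1 *m A ^+ m.

Definition is_wgmpinv (m : nat) A X : bool :=
  let A1 := A *m wginv m A *m A in
  [&& X *m A *m X == X, A *m X == A1 *m mpinv A & X *m A == drazin A *m A1].

Lemma drazinC A j : drazin A *m A ^+ j = A ^+ j *m drazin A.
Proof.
have /and3P[_ /eqP AD _] := drazinP A.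
by apply/commrX; rewrite /GRing.comm -!mulmxE AD.
Qed.

Lemma drazinAk A : drazin A *m A *m A ^+ mxindex A = A ^+ mxindex A.
Proof.
have /and3P[_ _ /eqP E] := drazinP A.
by rewrite -mulmxA mulmxE -exprS -mulmxE drazinC E.
Qed.

Lemma mul_cepinv A : A *m cepinv A = A ^+ mxindex A *m mpinv (A ^+ mxindex A).
Proof.
have /and3P[_ /eqP AD _] := drazinP A.
by rewrite /cepinv !mulmxA AD drazinAk.
Qed.

Lemma cepinv_mul_sqr A : A *m cepinv A *m cepinv A = cepinv A.
Proof.
have /and4P[/eqP AXA _ _ _] := mpinvP (A ^+ mxindex A).
rewrite mul_cepinv {1}/cepinv drazinC !mulmxA AXA.
by rewrite /cepinv drazinC.
Qed.

Lemma cepinvK A : cepinv A *m A *m cepinv A = cepinv A.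
Proof.
have /and4P[/eqP AXA _ _ _] := mpinvP (A ^+ mxindex A).
rewrite -mulmxA mul_cepinv {1}/cepinv !mulmxA; congr (_ *m _).
by rewrite -!mulmxA; congr (_ *m _); rewrite mulmxA.
Qed.

Lemma drazin_cepinv A : drazin A *m A *m cepinv A = cepinv A.
Proof. by rewrite {1}/cepinv drazinC !mulmxA drazinAk /cepinv drazinC. Qed.

Lemma expr_cepinv A j : A ^+ j.+1 *m cepinv A ^+ j.+1 = A *m cepinv A.
Proof.
elim: j => [|j IH]; first by rewrite !expr1.
have ACC : A * cepinv A * cepinv A = cepinv A by exact: cepinv_mul_sqr.
rewrite -[RHS]IH !mulmxE [A ^+ j.+2]exprSr [_ ^+ j.+2]exprS -mulrA; congr (_ * _).
by rewrite exprS mulrA mulrA ACC.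
Qed.

Lemma drazin_wginv m A : drazin A *m A *m wginv m A = wginv m A.
Proof.
rewrite /wginv exprS -mulmxE; move: (cepinv A) (drazin_cepinv A) => X DAX.
by rewrite !mulmxA DAX.
Qed.

Lemma wginvK m A : wginv m A *m A *m wginv m A = wginv m A.
Proof.
rewrite /wginv; move: (cepinv A) (cepinvK A) (expr_cepinv A m) => X XAX AXm.
rewrite !mulmxA; congr (_ *m _).
rewrite -(mulmxA (X ^+ _)) -[A ^+ m *m A]/(A ^+ m * A) -exprSr -mulmxA AXm.
by rewrite exprSr -mulmxE -mulmxA [X *m _]mulmxA XAX.
Qed.

Lemma wgmpinv_exists m A : exists X, is_wgmpinv m A X.
Proof.
have /and4P[/eqP AXA _ _ _] := mpinvP A.
rewrite /is_wgmpinv /=; move: (wginv m A) (wginvK m A) (drazin_wginv m A) => W WAW DAW.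
have XA : W *m A *m mpinv A *m A = W *m A.
  by rewrite -(mulmxA W) -(mulmxA W) AXA.
exists (W *m A *m mpinv A); apply/and3P; split; apply/eqP.
- by rewrite XA !mulmxA WAW.
- by rewrite !mulmxA.
- by rewrite XA !mulmxA DAW.
Qed.

Definition wgmpinv m A : 'M[C]_n := xchoose (wgmpinv_exists m A).

Lemma wgmpinvP m A : is_wgmpinv m A (wgmpinv m A).
Proof. exact: xchooseP. Qed.

Lemma wgmpinv_unique m A X Y : is_wgmpinv m A X -> is_wgmpinv m A Y -> X = Y.
Proof.
move=> /and3P[/eqP XAX /eqP AX /eqP XA] /and3P[/eqP YAY /eqP AY /eqP YA].
by rewrite -XAX -mulmxA AX -AY mulmxA XA -YA YAY.
Qed.

End Square.
End GeneralizedInverses.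

(* Main.v *)
Require Import Defs.
From HB Require Import structures.
From mathcomp Require Import all_boot all_order all_algebra.
From mathcomp Require Import reals complex.

(** Write [C] for the core-EP inverse of [A], [B = A ^+ k] with [k] the index,
    and [P = A *m C = B *m mpinv B], the orthogonal projector onto the range of
    [B].  The three defining equations of [X = wgmpinv m A] give
    [X = C ^+ m.+1 *m M] with [M = A ^+ m.+1 *m mpinv A] ([wgmpinvE]).

    The whole theorem is about two factorizations of [X].

    - [X] and [B] are right multiples of each other.  Indeed [C] starts with
      [B], because the Drazin inverse commutes with [A]; conversely, [C] undoes
      [A] on the range of [B] ([cepinvK_index]), whence
      [C ^+ j *m A ^+ j *m B = B] for every [j], and so [X *m A *m B = B].
      This gives the range and the rank.

    - [X] and [B^t* *m M] are left multiples of each other.  The passage from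
      [C ^+ m.+1] to [P] is left multiplication by [A ^+ m.+1], undone by
      [C ^+ m.+1]; for the passage from [P] to [B^t*], take adjoints in
      [P = B *m mpinv B] and [P *m B = B], as [P] is Hermitian.  So [C ^+ m.+1] and [B^t*] are left multiples
      of each other ([cepinv_expr_adj], [adj_cepinv_expr]), which persists after
      multiplication on the right by [M], or by [A ^+ m.+1] in the case of
      [X *m A].  This gives the null spaces.

    Finally [A *m X] and [X *m A] are idempotent since [X *m A *m X = X], and
    an idempotent matrix is the projector onto its range along its null space;
    [X *m A] has the range of [X] and [A *m X] its null space, while the two
    other subspaces are given by the factorizations above, together with the
    fact that [A] maps the range of [B] onto itself. *)

Set Implicit Arguments.
Unset Strict Implicit.
Unset Printing Implicit Defensive.

Import Order.TTheory GRing.Theory Num.Theory.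
Local Open Scope ring_scope.
Local Open Scope sesquilinear_scope.

Section RangeNull.
Variable F : fieldType.

Lemma mxrange_eq m n p (A : 'M[F]_(m, n)) (B : 'M_(m, p)) Y Z :
  A = B *m Y -> B = A *m Z -> mxrange A = mxrange B.
Proof.
move=> AE BE; apply/vspaceP=> y; apply/mxrangeP/mxrangeP=> [[x ->]|[x ->]].
  by exists (Y *m x); rewrite mulmxA -AE.
by exists (Z *m x); rewrite mulmxA -BE.
Qed.

Lemma mxrank_eq m n p (A : 'M[F]_(m, n)) (B : 'M_(m, p)) Y Z :
  A = B *m Y -> B = A *m Z -> \rank A = \rank B.
Proof.
move=> AE BE; apply/eqP; rewrite eqn_leq; apply/andP.
by split; [rewrite AE | rewrite BE]; apply: mxrankM_maxl.
Qed.

Lemma mxnull_eq m n p (A : 'M[F]_(m, n)) (B : 'M_(p, n)) Y Z :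
  A = Y *m B -> B = Z *m A -> mxnull A = mxnull B.
Proof.
move=> AE BE; apply/vspaceP=> x; rewrite !mxnullE.
apply/eqP/eqP=> E; first by rewrite BE -mulmxA E mulmx0.
by rewrite AE -mulmxA E mulmx0.
Qed.

Lemma idempotent_projector n (P : 'M[F]_n) :
  P *m P = P -> is_projector P (mxrange P) (mxnull P).
Proof.
move=> PP; have fixP u : u \in mxrange P -> P *m u = u.
  by case/mxrangeP=> x ->; rewrite mulmxA PP.
apply/is_projectorP; split=> //.
- apply/eqP; rewrite -subv0; apply/subvP=> x.
  rewrite memv_cap mxnullE memv0 => /andP[/fixP-> //].
- apply/vspaceP=> x; rewrite memvf.
  have -> : x = P *m x + (x - P *m x) by rewrite addrC subrK.
  apply: memv_add; first by apply/mxrangeP; exists x.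
  by rewrite mxnullE mulmxBr mulmxA PP subrr.
- by move=> v; rewrite mxnullE => /eqP.
Qed.

End RangeNull.

Section WeakGroupMP.
Variables (C : numClosedFieldType) (n : nat).
Implicit Types A : 'M[C]_n.

Lemma index_mulC A : A *m A ^+ mxindex A = A ^+ mxindex A *m A.
Proof. by rewrite mulmxE -exprS exprSr. Qed.

Lemma cepinv_fact A :
  cepinv A = A ^+ mxindex A *m (drazin A *m mpinv (A ^+ mxindex A)).
Proof. by rewrite /cepinv drazinC mulmxA. Qed.

Lemma cepinvK_index A :
  cepinv A *m A *m A ^+ mxindex A = A ^+ mxindex A.
Proof.
have /and4P[/eqP BYB _ _ _] := mpinvP (A ^+ mxindex A).
rewrite -mulmxA index_mulC /cepinv !mulmxA.
rewrite -(mulmxA (drazin A)) -(mulmxA (drazin A)) BYB.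
by rewrite -mulmxA -index_mulC mulmxA drazinAk.
Qed.

(** The factors of [cepinv A ^+ j *m A ^+ j] cancel from the inside out, as
    powers of [A] leave the range of [A ^+ mxindex A] invariant. *)
Lemma cepinv_exprK_index A j :
  cepinv A ^+ j *m A ^+ j *m A ^+ mxindex A = A ^+ mxindex A.
Proof.
move: (cepinv A) (cepinvK_index A) => X XAB.
elim: j => [|j IH]; first by rewrite !expr0 !mulmxE !mul1r.
have AB : A ^+ j *m A ^+ mxindex A = A ^+ mxindex A *m A ^+ j.
  by rewrite mulmxE -!exprD addnC.
rewrite exprSr exprS -!mulmxE -!mulmxA AB.
rewrite [X *m (A *m _)]mulmxA [X *m A *m _]mulmxA XAB -AB.
by rewrite mulmxA.
Qed.

Lemma cepinv_expr_core A j :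
  cepinv A ^+ j.+1 *m (A *m cepinv A) = cepinv A ^+ j.+1.
Proof.
move: (cepinv A) (cepinvK A) => X XAX.
by rewrite exprSr -mulmxE -mulmxA [X *m (A *m _)]mulmxA XAX.
Qed.

Lemma core_adj A :
  A *m cepinv A = (mpinv (A ^+ mxindex A))^t* *m (A ^+ mxindex A)^t*.
Proof.
have /and4P[_ _ /eqP BYs _] := mpinvP (A ^+ mxindex A).
by rewrite mul_cepinv -BYs adjmxM.
Qed.

Lemma adj_core A :
  (A ^+ mxindex A)^t* *m (A *m cepinv A) = (A ^+ mxindex A)^t*.
Proof.
have /and4P[/eqP BYB _ /eqP BYs _] := mpinvP (A ^+ mxindex A).
by rewrite mul_cepinv -BYs -adjmxM BYB.
Qed.

(** [cepinv A ^+ j.+1] and the adjoint of [A ^+ mxindex A] both have the null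
    space of the orthogonal projector [A *m cepinv A].  Stating this by left
    divisibility, here and in the next lemma, makes it survive multiplication on
    the right. *)
Lemma cepinv_expr_adj A j :
  cepinv A ^+ j.+1 =
  cepinv A ^+ j.+1 *m (mpinv (A ^+ mxindex A))^t* *m (A ^+ mxindex A)^t*.
Proof. by rewrite -mulmxA -core_adj cepinv_expr_core. Qed.

Lemma adj_cepinv_expr A j :
  (A ^+ mxindex A)^t* = (A ^+ mxindex A)^t* *m A ^+ j.+1 *m cepinv A ^+ j.+1.
Proof. by rewrite -mulmxA expr_cepinv adj_core. Qed.

Lemma mxnull_cepinv_expr p j A (M : 'M[C]_(n, p)) :
  mxnull (cepinv A ^+ j.+1 *m M) = mxnull ((A ^+ mxindex A)^t* *m M).
Proof.
apply: mxnull_eq; first by rewrite {1}cepinv_expr_adj -mulmxA.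
by rewrite {1}(adj_cepinv_expr A j) -mulmxA.
Qed.

Lemma wgmpinv_mul_wginv m A : wgmpinv m A *m A = wginv m A *m A.
Proof.
have /and3P[_ _ /eqP ->] := wgmpinvP m A.
by move: (wginv m A) (drazin_wginv m A) => W DAW; rewrite !mulmxA DAW.
Qed.

(** The Moore-Penrose factor of [wgmpinv m A] is absorbed by [A], which is why
    the null space of this product does not involve [mpinv A]. *)
Lemma wgmpinv_mul m A : wgmpinv m A *m A = cepinv A ^+ m.+1 *m A ^+ m.+1.
Proof.
rewrite wgmpinv_mul_wginv /wginv -mulmxA; congr (_ *m _).
by rewrite mulmxE -exprSr.
Qed.

Lemma wgmpinvE m A : wgmpinv m A = cepinv A ^+ m.+1 *m (A ^+ m.+1 *m mpinv A).
Proof.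
have /and3P[/eqP XAX /eqP AX _] := wgmpinvP m A.
rewrite [RHS]mulmxA -wgmpinv_mul wgmpinv_mul_wginv -XAX -mulmxA AX.
move: (wgmpinv m A) (wginv m A) (wgmpinv_mul_wginv m A) (wginvK m A).
by move=> X W XA WAW; rewrite !mulmxA XA WAW.
Qed.

Lemma wgmpinv_fact m A : exists Y, wgmpinv m A = A ^+ mxindex A *m Y.
Proof. by rewrite wgmpinvE exprS -mulmxE {1}cepinv_fact -!mulmxA; eexists. Qed.

Lemma wgmpinvK_index m A :
  wgmpinv m A *m A *m A ^+ mxindex A = A ^+ mxindex A.
Proof. by rewrite wgmpinv_mul cepinv_exprK_index. Qed.

Lemma mxrange_wgmpinv m A : mxrange (wgmpinv m A) = mxrange (A ^+ mxindex A).
Proof.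
have [Y XE] := wgmpinv_fact m A; apply: (mxrange_eq XE).
by rewrite -[LHS](wgmpinvK_index m) -mulmxA.
Qed.

Lemma mxrank_wgmpinv m A : \rank (wgmpinv m A) = \rank (A ^+ mxindex A).
Proof.
have [Y XE] := wgmpinv_fact m A; apply: (mxrank_eq XE).
by rewrite -[LHS](wgmpinvK_index m) -mulmxA.
Qed.

Lemma mxnull_wgmpinv m A :
  mxnull (wgmpinv m A) = mxnull ((A ^+ mxindex A)^t* *m A ^+ m.+1 *m mpinv A).
Proof. by rewrite wgmpinvE mxnull_cepinv_expr mulmxA. Qed.

Lemma wgmpinv_outer m A : wgmpinv m A *m A *m wgmpinv m A = wgmpinv m A.
Proof. by have /and3P[/eqP] := wgmpinvP m A. Qed.

(** [A] maps the range of [A ^+ mxindex A] onto itself, its inverse there being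
    the Drazin inverse; hence [A *m wgmpinv m A] inherits the range of
    [wgmpinv m A]. *)
Lemma mxrange_mul_wgmpinv m A :
  mxrange (A *m wgmpinv m A) = mxrange (A ^+ mxindex A).
Proof.
have [Y XE] := wgmpinv_fact m A.
apply: (@mxrange_eq _ _ _ _ _ _ (A *m Y) (A *m A ^+ mxindex A *m drazin A)).
  by rewrite XE !mulmxA index_mulC.
have /and3P[_ _ /eqP] := drazinP A; rewrite exprS -mulmxE => {1}<-.
by rewrite -{1}(wgmpinvK_index m A) !mulmxA.
Qed.

Lemma wgmpinv_projectors m A :
  let N := mxnull ((A ^+ mxindex A)^t* *m A ^+ m.+1 *m mpinv A) in
  is_projector (A *m wgmpinv m A) (mxrange (A ^+ mxindex A)) N /\
  is_projector (wgmpinv m A *m A) (mxrange (A ^+ mxindex A))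
    (mxnull ((A ^+ mxindex A)^t* *m A ^+ m.+1)).
Proof.
have XAX := wgmpinv_outer m A.
have XAX' : wgmpinv m A *m (A *m wgmpinv m A) = wgmpinv m A by rewrite mulmxA.
split.
- rewrite -(mxrange_mul_wgmpinv m) -mxnull_wgmpinv.
  have <- : mxnull (A *m wgmpinv m A) = mxnull (wgmpinv m A).
    exact: (mxnull_eq (erefl _) (esym XAX')).
  by apply: idempotent_projector; rewrite -mulmxA XAX'.
- rewrite -(mxrange_wgmpinv m).
  have <- : mxrange (wgmpinv m A *m A) = mxrange (wgmpinv m A).
    exact: (mxrange_eq (erefl _) (esym XAX)).
  have <- : mxnull (wgmpinv m A *m A) = mxnull ((A ^+ mxindex A)^t* *m A ^+ m.+1).
    by rewrite wgmpinv_mul mxnull_cepinv_expr.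
  by apply: idempotent_projector; rewrite mulmxA XAX.
Qed.

End WeakGroupMP.

Theorem theorem3p9 (R : realType) (n : nat) (A : 'M[R[i]]_n) (k m : nat)
    (hk : mxindex A = k) (hm : (0 < m)%N) :
  let X := wgmpinv m A in
  let N := mxnull ((A ^+ k)^t* *m A ^+ m.+1 *m mpinv A) in
  [/\ (* (a) *) \rank X = \rank (A ^+ k),
      (* (b) *) mxrange X = mxrange (A ^+ k) /\ mxnull X = N,
      (* (c) *) is_outer_inverse A (mxrange (A ^+ k)) N X,
      (* (d) *) is_projector (A *m X) (mxrange (A ^+ k)) N
    & (* (e) *) is_projector (X *m A) (mxrange (A ^+ k))
                  (mxnull ((A ^+ k)^t* *m A ^+ m.+1))].
Proof.
case: k / hk; have [AXproj XAproj] := wgmpinv_projectors m A.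
split.
- exact: mxrank_wgmpinv.
- by split; [exact: mxrange_wgmpinv | exact: mxnull_wgmpinv].
- split; [exact: wgmpinv_outer | exact: mxrange_wgmpinv | exact: mxnull_wgmpinv].
- exact: AXproj.
- exact: XAproj.
Qed.
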